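(* Let $P_l^m$ (integers $0\le m\le l$) denote the associated Legendre functions and $P_l=P_l^0$ the Legendre polynomials. Then: (a) For $m=0$ and $l\ge 0$: $P_2\mid P_l$ if and only if $l=2$. (b) For $m=2$ and $l\ge 2$: $P_2\mid P_l^2$ if and only if $l=5$. (c) If $m\ge 0$ is even, then there exists at most one integer $l\ge m$ such that $P_2\mid P_l^m$. (d) If $m\ge 1$ is odd, then $P_2\nmid P_l^m$ for all integers $l\ge m$.
   Context: For integers $0\le m\le l$ and $x\in[-1,1]$, the associated Legendre function is $$P_l^m(x)=i^m\frac{(l+m)!}{l!}\frac1\pi\int_0^\pi (x+y\cos\varphi)^l\cos(m\varphi)\,d\varphi,\qquad y=i\sqrt{1-x^2}.$$ In particular $P_2(x)=\tfrac12(3x^2-1)$. If $m$ is even, $P_l^m$ is a polynomial in $x$ and $P_2\mid P_l^m$ means divisibility of polynomials. If $m$ is odd, $P_l^m/\sqrt{1-x^2}$ is a polynomial in $x$ and $P_2\mid P_l^m$ means that $P_2$ divides the polynomial $P_l^m/\sqrt{1-x^2}$. *)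

(* Defs.v *)
(* The integral representation lives over Stdlib's [R], with Coquelicot's complex
   numbers and Riemann integral; the polynomial parts of the associated Legendre
   functions are MathComp polynomials in [{poly R}].  MathComp
   rebinds the key [%R] to [ring_scope]; [%coqR] denotes Stdlib's [R_scope]. *)
From Stdlib Require Import Reals Lra.
From Coquelicot Require Import Coquelicot.
From mathcomp Require Import all_boot.

Delimit Scope R_scope with coqR.

Set Implicit Arguments.
Unset Strict Implicit.
Unset Printing Implicit Defensive.

Local Open Scope R_scope.
Local Open Scope C_scope.

Definition legendre_y (x : R) : C := Ci * RtoC (sqrt (1 - x ^ 2)).

Definition legendre_integrand (l m : nat) (x phi : R) : C :=
  (RtoC x + legendre_y x * RtoC (cos phi)) ^ l * RtoC (cos (INR m * phi)).

(* Total in [l], [m], [x]; meaningful for m <= l and -1 <= x <= 1. *)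
Definition assoc_legendre (l m : nat) (x : R) : C :=
  Ci ^ m * RtoC (INR (l + m)`! / INR l`!) * RtoC (1 / PI) *
  RInt (V := C_R_CompleteNormedModule) (legendre_integrand l m x) 0 PI.

Lemma is_RInt_Cmult (f : R -> C) (a b : R) (c v : C) :
  is_RInt (V := C_R_NormedModule) f a b v ->
  is_RInt (V := C_R_NormedModule) (fun t => c * f t) a b (c * v).
Proof.
move=> Hf.
have H1 := is_RInt_fct_extend_fst _ _ _ _ Hf.
have H2 := is_RInt_fct_extend_snd _ _ _ _ Hf.
apply: is_RInt_fct_extend_pair => /=.
- apply: (is_RInt_minus (V := R_NormedModule)).
  + exact: (is_RInt_scal (V := R_NormedModule) _ _ _ (fst c) _ H1).
  + exact: (is_RInt_scal (V := R_NormedModule) _ _ _ (snd c) _ H2).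
- apply: (is_RInt_plus (V := R_NormedModule)).
  + exact: (is_RInt_scal (V := R_NormedModule) _ _ _ (fst c) _ H2).
  + exact: (is_RInt_scal (V := R_NormedModule) _ _ _ (snd c) _ H1).
Qed.

Lemma sin_nat_PI (m : nat) : sin (INR m * PI) = 0%coqR.
Proof. by apply: sin_eq_0_1; exists (Z.of_nat m); rewrite INR_IZR_INZ. Qed.

Lemma is_RInt_legendre0 (m : nat) (x : R) :
  is_RInt (V := C_R_NormedModule) (legendre_integrand 0 m x) 0 PI
    (RtoC (if m is 0%N then PI else 0)).
Proof.
have H : is_RInt (fun t : R => cos (INR m * t)) 0 PI (if m is 0%N then PI else 0%coqR).
  case: m => [|m].
    apply: (is_RInt_ext (fun _ => 1%coqR)) => [t _|].
      by rewrite /= Rmult_0_l cos_0.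
    have := is_RInt_const (V := R_NormedModule) 0 PI 1.
    by rewrite /scal /= /mult /= Rminus_0_r Rmult_1_r.
  have m0 : (INR m.+1 <> 0)%coqR by apply: not_0_INR.
  have s0 := sin_nat_PI m.+1; move: (INR m.+1) m0 s0 => k m0 s0.
  evar_last.
    apply (is_RInt_derive (V := R_CompleteNormedModule)
      (fun t => sin (k * t) / k)%coqR) => t _; last first.
      apply: (ex_derive_continuous (V := R_NormedModule)).
      exists (- (k * sin (k * t)))%coqR.
      by auto_derive => //; ring.
    by auto_derive => //; field.
  rewrite s0 Rmult_0_r sin_0 /minus /plus /opp /=; lra.
apply: is_RInt_fct_extend_pair.
  apply: is_RInt_ext H => t _; rewrite /legendre_integrand /=; ring.
apply: (is_RInt_ext (fun _ => 0%coqR)) => [t _|].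
  rewrite /legendre_integrand /=; ring.
have := is_RInt_const (V := R_NormedModule) 0 PI 0.
by rewrite /scal /= /mult /= Rmult_0_r.
Qed.

(* |m - 1| *)
Definition dist1 (m : nat) : nat := if m is m'.+1 then m' else 1.

Lemma legendre_integrandS (l m : nat) (x phi : R) :
  legendre_integrand l.+1 m x phi =
    RtoC x * legendre_integrand l m x phi +
    legendre_y x * RtoC (/ 2) *
      (legendre_integrand l m.+1 x phi + legendre_integrand l (dist1 m) x phi).
Proof.
rewrite /legendre_integrand.
have E : RtoC (cos phi) * RtoC (cos (INR m * phi)) =
    RtoC (/ 2) * (RtoC (cos (INR m.+1 * phi)) + RtoC (cos (INR (dist1 m) * phi))).
  rewrite -RtoC_mult -RtoC_plus -RtoC_mult; congr RtoC.
  case: m => [|m].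
    by rewrite /= Rmult_0_l cos_0 Rmult_1_l; field.
  have -> : (INR m.+2 * phi = INR m.+1 * phi + phi)%coqR by rewrite (S_INR m.+1); ring.
  have -> : (INR (dist1 m.+1) * phi = INR m.+1 * phi - phi)%coqR.
    by rewrite /dist1 S_INR; ring.
  by rewrite cos_plus cos_minus; field.
rewrite [_ ^ l.+1]/=.
transitivity (RtoC x * ((RtoC x + legendre_y x * RtoC (cos phi)) ^ l *
    RtoC (cos (INR m * phi))) + legendre_y x *
    (RtoC x + legendre_y x * RtoC (cos phi)) ^ l *
    (RtoC (cos phi) * RtoC (cos (INR m * phi)))); first by ring.
by rewrite E; ring.
Qed.

Lemma CiM : Ci * Ci = RtoC (-1).
Proof. by rewrite /Ci /Cmult /RtoC /=; congr (_, _); ring. Qed.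

Lemma legendre_y_sqr (x : R) :
  -1 <= x <= 1 -> legendre_y x * legendre_y x = RtoC (x ^ 2 - 1).
Proof.
move=> hx; rewrite /legendre_y.
have h : (0 <= 1 - x ^ 2)%coqR by nra.
transitivity (Ci * Ci * RtoC (sqrt (1 - x ^ 2) * sqrt (1 - x ^ 2))).
  by rewrite RtoC_mult; ring.
rewrite sqrt_sqrt // CiM -RtoC_mult; congr RtoC; ring.
Qed.

Lemma Ci_even (n : nat) : ~~ odd n -> Ci ^ n = RtoC ((-1) ^ n./2).
Proof.
move=> hn; rewrite -{1}[n]even_halfK //; elim: n./2 => [|k IH] //.
rewrite doubleS [LHS]/= IH.
have -> : ((-1) ^ k.+1 = -1 * (-1) ^ k)%coqR by [].
by rewrite RtoC_mult -CiM; ring.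
Qed.

From mathcomp Require Import all_order all_algebra.
From mathcomp Require Import boolp Rstruct.

Import GRing.Theory Num.Theory.
Local Open Scope ring_scope.

(* (1/pi) times the integral, divided by y when m is odd. *)
Fixpoint legendre_int_poly (l m : nat) : {poly R} :=
  if l is l'.+1 then
    'X * legendre_int_poly l' m +
    (if odd m then 1 else 'X^2 - 1) * (2^-1)%:P *
      (legendre_int_poly l' m.+1 + legendre_int_poly l' (dist1 m))
  else (m == 0%N)%:R.

Lemma is_RInt_legendre (l m : nat) (x : R) :
  (-1 <= x <= 1)%coqR ->
  is_RInt (V := C_R_NormedModule) (legendre_integrand l m x) 0%coqR PI
    (RtoC PI * legendre_y x ^ odd m * RtoC (legendre_int_poly l m).[x])%C.
Proof.
move=> hx; have y2 := legendre_y_sqr hx.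
elim: l m => [|l IH] m.
  evar_last; first exact: is_RInt_legendre0.
  by case: m => [|m] /=; rewrite ?hornerE -?R1E -?R0E; ring.
apply: (is_RInt_ext (fun t => (RtoC x * legendre_integrand l m x t +
    legendre_y x * RtoC (/ 2)%coqR * (legendre_integrand l m.+1 x t +
      legendre_integrand l (dist1 m) x t))%C)) => [t _|].
  by rewrite legendre_integrandS.
evar_last.
  apply: (is_RInt_plus (V := C_R_NormedModule)).
    apply: is_RInt_Cmult; exact: (IH m).
  apply: is_RInt_Cmult; apply: (is_RInt_plus (V := C_R_NormedModule)).
    exact: (IH m.+1).
  exact: (IH (dist1 m)).
have od : odd (dist1 m) = ~~ odd m by case: m => [|m] //=; rewrite negbK.
rewrite /= od !hornerE.
set p := (legendre_int_poly l m).[x].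
set q := (legendre_int_poly l m.+1).[x].
set r := (legendre_int_poly l (dist1 m)).[x].
have -> : (x * p + (if odd m then 1 else 'X^2 - 1).[x] * 2^-1 * (q + r)) =
   (x * p + (if odd m then 1 else x ^ 2 - 1) * / 2 * (q + r))%coqR :> R.
  by case: (odd m); rewrite !hornerE ?RpowE.
rewrite !(RtoC_plus, RtoC_mult).
change (@plus _) with Cplus.
case: (odd m) => /=; last rewrite -y2; ring.
Qed.

(* [p] is P_l^m itself for even m, and P_l^m / sqrt (1 - x^2) for odd m. *)
Definition is_legendre_poly (l m : nat) (p : {poly R}) : Prop :=
  forall x : R, (-1 <= x <= 1)%coqR ->
    assoc_legendre l m x =
      RtoC (if odd m then (sqrt (1 - x ^ 2) * p.[x])%coqR else p.[x]).

Definition legendre_factor (l m : nat) : R :=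
  ((-1) ^ uphalf m * (INR (l + m)`! / INR l`!))%coqR.

Lemma is_legendre_poly_int (l m : nat) :
  is_legendre_poly l m (legendre_factor l m *: legendre_int_poly l m).
Proof.
move=> x hx; rewrite /assoc_legendre.
rewrite (is_RInt_unique (V := C_R_CompleteNormedModule) _ _ _ _
           (is_RInt_legendre hx)) hornerZ.
have : (Ci ^ (m + odd m)%N = RtoC ((-1) ^ uphalf m)%coqR)%C.
  rewrite Ci_even; last by rewrite oddD oddb addbb.
  by rewrite uphalf_half halfD oddb andbb; case: (odd m) => /=; rewrite addn0.
rewrite /legendre_factor.
move: (uphalf m) (legendre_int_poly l m).[x] => k p E.
have pi1 : (RtoC (1 / PI)%coqR * RtoC PI)%C = RtoC 1%coqR.
  by rewrite -RtoC_mult; congr RtoC; field; exact: PI_neq0.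
move: (INR _ / INR _)%coqR => c.
transitivity (Ci ^ m * RtoC c * (RtoC (1 / PI)%coqR * RtoC PI) *
    (legendre_y x ^ odd m * RtoC p))%C; first by ring.
rewrite pi1.
have -> : (((-1) ^ k * c)%coqR * p) = ((-1) ^ k * c * p)%coqR :> R by [].
move: E; case: (odd m) => [|]; rewrite ?addn0 ?addn1 => E.
  rewrite !RtoC_mult -E /legendre_y.
  have -> : (Ci ^ m.+1 = Ci * Ci ^ m)%C by [].
  by move: (sqrt _) => s; rewrite [(_ ^ true)%C]/=; ring.
by rewrite !RtoC_mult -E [(_ ^ false)%C]/=; ring.
Qed.

Lemma is_legendre_poly_uniq (l m : nat) (p q : {poly R}) :
  is_legendre_poly l m p -> is_legendre_poly l m q -> p = q.
Proof.
move=> hp hq; apply/eqP; rewrite -subr_eq0; apply/negPn/negP => nz.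
pose s := [seq (k.+2%:R : R)^-1 | k <- iota 0 (size (p - q))].
have us : uniq s.
  rewrite map_inj_uniq ?iota_uniq // => i j /invr_inj /eqP.
  by rewrite eqr_nat !eqSS => /eqP.
have rs : all (root (p - q)) s.
  apply/allP => _ /mapP[k _ ->]; rewrite rootE !hornerE subr_eq0.
  set x : R := _^-1.
  have hx : (0 < x < 1)%coqR.
    split; apply/RltP; rewrite ?R0E ?R1E /x ?invr_gt0 ?ltr0n //.
    by rewrite invf_lt1 ?ltr0n // ltr1n.
  have hx' : (-1 <= x <= 1)%coqR by lra.
  have := hp x hx'; rewrite (hq x hx') => /RtoC_inj.
  case: (odd m) => [H|->] //.
  apply/eqP/esym; apply: Rmult_eq_reg_l H _.
  by apply: Rgt_not_eq; apply: sqrt_lt_R0; nra.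
by have := max_poly_roots nz rs us; rewrite size_map size_iota ltnn.
Qed.

Lemma is_legendre_poly_ex (l m : nat) : exists p, is_legendre_poly l m p.
Proof. by eexists; exact: is_legendre_poly_int. Qed.

(* The unique polynomial given by [is_legendre_poly l m]; divisibility of P_l^m
   by P_2 means divisibility of this polynomial. *)
Definition assoc_legendre_poly (l m : nat) : {poly R} :=
  sval (cid (is_legendre_poly_ex l m)).

Lemma assoc_legendre_polyP (l m : nat) :
  is_legendre_poly l m (assoc_legendre_poly l m).
Proof. exact: svalP. Qed.

Definition legendre_poly (l : nat) : {poly R} := assoc_legendre_poly l 0.

From mathcomp Require Import ring.

Lemma legendre_poly2 : legendre_poly 2 = 2^-1 *: (3 *: 'X^2 - 1).
Proof.
apply: (is_legendre_poly_uniq (assoc_legendre_polyP 2 0)).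
suff -> : 2^-1 *: (3 *: 'X^2 - 1) =
    legendre_factor 2 0 *: legendre_int_poly 2 0 by exact: is_legendre_poly_int.
have -> : legendre_factor 2 0 = 1.
  have n0 : INR 2`! <> 0%coqR by exact: not_0_INR.
  by rewrite /legendre_factor addn0 /Rdiv Rinv_r // Rmult_1_r.
rewrite scale1r /= -!mul_polyC polyCMn.
have h2 : ((2^-1)%:P * 2 : {poly R}) = 1 by rewrite -polyC_natr -polyCM mulVf ?pnatr_eq0.
move: (2^-1)%:P h2 => h h2; apply/eqP; rewrite -subr_eq0; apply/eqP.
transitivity (('X^2 - ('X^2 - 1) * h) * (h * 2 - 1)); first by ring.
by rewrite h2 subrr mulr0.
Qed.

(* Main.v *)
(** At x = 1/sqrt 3 the integral of P_l^m is, up to a nonzero factor, the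
    coefficient T(l, m) of z^m in (1 + z - 1/(2z))^l, so P_2 divides P_l^m iff
    T(l, m) = 0.  Write l = m + 2K + e with e in {0, 1} and M = m + K.  Reversing
    the order of summation, T(l, m) is a nonzero multiple of
      S = sum_j (-1)^j K(K-1)...(K-j+1) C(M, j) / ((1+2e)(3+2e)...(2j-1+2e)),
    whose terms are 2-adic integers.  Modulo 2, S = 1 + KM, so a zero needs K and
    M odd, hence m even.  For K = 2a+1 and M = 2c+1, adding the terms of index 2i
    and 2i+1 gives 2^(i+1) X_i(a, c) up to a 2-adic unit.  Modulo 4 this shows that
    e is the parity of m/2.  With n = c - a = m/2 fixed, X_i(a, a+n) - X_i(b, b+n)
    is divisible by a - b, and the terms i = 0, 1 give S(a) - S(b) = 4(a - b) times
    an odd 2-adic integer; so S has at most one zero, which determines l. *)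
From Stdlib Require Import Rdefinitions RIneq.
Require Import Defs.
From mathcomp Require Import all_boot all_order all_algebra.
From mathcomp Require Import Rstruct.
From mathcomp Require Import zify ring.
Import GRing.Theory Num.Theory.
Local Open Scope ring_scope.

(** * The trinomial coefficients T(l, m) and the values of P_l^m at 3 x^2 = 1 *)

Lemma sum_ord_widen (V : nmodType) (m n : nat) (f : nat -> V) : (m <= n)%N ->
  (forall k, (m <= k)%N -> f k = 0) -> \sum_(k < n) f k = \sum_(k < m) f k.
Proof.
move=> mn f0; rewrite -!(big_mkord xpredT) (big_cat_nat (n := m)) //=.
rewrite [X in _ + X]big1_seq ?addr0 // => k /andP[_].
by rewrite mem_index_iota => /andP[mk _]; exact: f0.
Qed.

(* The coefficient of z^m in (1 + z - 1/(2z))^l. *)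
Definition trinom {F : numFieldType} (l m : nat) : F :=
  \sum_(k < l.+1) ('C(l, m + k.*2) * 'C(m + k.*2, k))%:R * (- 2^-1) ^+ k.

Lemma trinom_widen (F : numFieldType) (l m N : nat) : (l < N)%N ->
  trinom l m = \sum_(k < N) ('C(l, m + k.*2) * 'C(m + k.*2, k))%:R * (- 2^-1) ^+ k :> F.
Proof.
move=> lN; rewrite /trinom; apply/esym.
apply: (@sum_ord_widen F _ _
    (fun k => ('C(l, m + k.*2) * 'C(m + k.*2, k))%:R * (- 2^-1) ^+ k)) => // k lk.
by rewrite bin_small ?mul0r //; lia.
Qed.

(** One more factor gives T(l, 0) + T(l, -1) - T(l, 1) / 2. The symmetry z -> -1/(2z) gives T(l, -1)
    = - T(l, 1) / 2; in the sum it appears as the doubling of a central binomial coefficient. *)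
Lemma trinom0S (F : numFieldType) (l : nat) :
  trinom l.+1 0 = trinom l 0 - trinom l 1 :> F.
Proof.
rewrite (@trinom_widen F l.+1 0 l.+3) // (@trinom_widen F l 0 l.+3); last lia.
rewrite (@trinom_widen F l 1 l.+2) // [LHS]big_ord_recl [X in _ = X - _]big_ord_recl.
rewrite -addrA !bin0; congr (_ + _); rewrite -sumrB; apply: eq_bigr => k _.
rewrite lift0 !add0n add1n doubleS binS.
have -> : 'C(k.*2.+2, k.+1) = (2 * 'C(k.*2.+1, k))%N.
  rewrite binS mulSn mul1n; congr (_ + _)%N; rewrite -bin_sub; last lia.
  by congr 'C(_, _); lia.
rewrite !natrM natrD exprS; by field.
Qed.

Lemma trinomSS (F : numFieldType) (l m : nat) :
  trinom l.+1 m.+1 = trinom l m.+1 + trinom l m - trinom l m.+2 / 2 :> F.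
Proof.
rewrite (@trinom_widen F l.+1 m.+1 l.+3) // (@trinom_widen F l m.+1 l.+3); last lia.
rewrite (@trinom_widen F l m l.+3); last lia.
rewrite (@trinom_widen F l m.+2 l.+2) // mulr_suml.
under eq_bigr do rewrite addSn binS mulnDl natrD mulrDl.
rewrite big_split -addrA; congr (_ + _); rewrite /=.
rewrite [LHS]big_ord_recl [X in _ = X - _]big_ord_recl -addrA; congr (_ + _).
  by rewrite !addn0 !bin0.
rewrite -sumrB; apply: eq_bigr => k _.
rewrite lift0 doubleS !addnS !addSn binS mulnDr natrD !natrM exprS; by field.
Qed.

(* (i / sqrt 2)^m, divided by i sqrt 2 when m is odd: for 3 x^2 = 1 one has
   y = i sqrt 2 x, and [legendre_int_poly] divides the integral by y for odd m. *)
Definition parity_scale {F : numFieldType} (m : nat) : F := (-1) ^+ m./2 / 2 ^+ uphalf m.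

Lemma parity_scaleS (F : numFieldType) (m : nat) :
  parity_scale m.+1 = (if odd m then -1 else 2^-1) * parity_scale m :> F.
Proof.
rewrite /parity_scale /= uphalfE /= uphalf_half.
by case: (odd m); rewrite ?add0n ?add1n !exprS; field; rewrite expf_neq0 // pnatr_eq0.
Qed.

Lemma parity_scale_neq0 (F : numFieldType) (m : nat) : parity_scale m != 0 :> F.
Proof.
by rewrite mulf_neq0 ?invr_eq0 ?expf_neq0 ?oppr_eq0 ?oner_eq0 ?pnatr_eq0.
Qed.

(** With y = i sqrt 2 x and z = (i / sqrt 2) e^(i phi), x + y cos phi = x (1 + z - 1/(2z)), so the
    integral extracts the coefficient of z^m. The proof matches the recurrences in l, using x^2 - 1
    = - 2 x^2. *)
Lemma horner_legendre_int_poly (x : R) (l m : nat) : 3 * x ^+ 2 = 1 ->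
  x ^+ odd m * (legendre_int_poly l m).[x] = x ^+ l * parity_scale m * trinom l m.
Proof.
move=> x3; have x1 : x ^+ 2 - 3 * x ^+ 2 = - 2 * x ^+ 2 by ring.
rewrite x3 in x1.
have : parity_scale 0 = 1 :> R by rewrite /parity_scale divr1.
move: (@parity_scale R) (@parity_scaleS R) => rho rhoS rho0.
have hS l' m' : (legendre_int_poly l'.+1 m').[x] = x * (legendre_int_poly l' m').[x] +
    (if odd m' then 1 else x ^+ 2 - 1) / 2 *
      ((legendre_int_poly l' m'.+1).[x] + (legendre_int_poly l' (dist1 m')).[x]).
  by rewrite /= !hornerE; case: (odd m'); rewrite !hornerE.
rewrite x1 in hS.
elim: l m => [|l IH] m.
  rewrite /trinom big_ord1 double0 addn0 bin0 muln1 bin0n expr0 mulr1.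
  case: m => [|m]; last by rewrite horner0 !mulr0.
  by rewrite /= hornerC rho0 !mulr1.
case: m => [|m]; rewrite hS.
  have := IH 0%N; have := IH 1%N; rewrite /= trinom0S rhoS /= expr1 expr0 mul1r.
  set v1 := (_.[_]); set v0 := (_.[_]) => h1 h0.
  have -> : 1 * (x * v0 + - 2 * x ^+ 2 / 2 * (v1 + v1)) = x * v0 - 2 * x * (x * v1) by field.
  by rewrite h0 h1 exprS; field.
have := IH m; have := IH m.+1; have := IH m.+2.
rewrite trinomSS !rhoS /= negbK [x ^+ l.+1]exprS.
set v2 := (_.[_]); set v1 := (_.[_]); set v0 := (_.[_]).
case: (odd m); rewrite /= ?expr0 ?expr1 ?mul1r => h2 h1 h0.
  have -> : x * v1 + - 2 * x ^+ 2 / 2 * (v2 + v0) = x * v1 - x * (x * v2 + x * v0) by field.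
  by rewrite h0 h1 h2; field.
have -> : x * (x * v1 + 2^-1 * (v2 + v0)) = x * (x * v1) + x / 2 * (v2 + v0) by field.
by rewrite h0 h1 h2; field.
Qed.

(** * The reversed sum S with odd denominators *)

(* (2j-1)!! for e = 0 and (2j+1)!! for e = 1. *)
Definition odd_fact (e : bool) (j : nat) : nat := \prod_(t < j) (t.*2 + e.*2).+1.

Lemma fact_odd_fact (e : bool) (j : nat) :
  ((j.*2 + e)`! = 2 ^ j * j`! * odd_fact e j)%N.
Proof.
rewrite /odd_fact; elim: j => [|j IH]; first by rewrite big_ord0; case: e.
rewrite big_ord_recr /= doubleS !addSn !factS IH expnS.
by case: (e); rewrite /= ?double0; nia.
Qed.

Lemma odd_fact_gt0 (e : bool) (j : nat) : (0 < odd_fact e j)%N.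
Proof. exact: prodn_gt0. Qed.

(** The sum S. Terms with j > K vanish, so every N > K gives the same value, and sums for different
    K can share one range. *)
Definition alt_sum {F : numFieldType} (e : bool) (N K M : nat) : F :=
  \sum_(j < N) (-1) ^+ j * (K ^_ j * 'C(M, j))%:R / (odd_fact e j)%:R.

(** Put k = K - j. The term is l! / (k! (m+k)! (2j+e)!) times (-1/2)^k, and the 2^j in (2j+e)! turns
    (-1/2)^k into (-1/2)^K (-1)^j. *)
Lemma trinom_alt_sum (F : numFieldType) (e : bool) (N K m : nat) : (K < N)%N ->
  trinom (m + K.*2 + e) m =
    ((m + K.*2 + e)`!%:R / (K`! * (m + K)`!)%:R * (- 2^-1) ^+ K)
      * alt_sum e N K (m + K) :> F.
Proof.
move=> KN; set l := (m + K.*2 + e)%N.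
transitivity (\sum_(k < K.+1) ('C(l, m + k.*2) * 'C(m + k.*2, k))%:R * (- 2^-1) ^+ k : F).
  apply: (@sum_ord_widen F _ _
    (fun k => ('C(l, m + k.*2) * 'C(m + k.*2, k))%:R * (- 2^-1) ^+ k)).
    by rewrite /l; lia.
  by move=> k Kk; rewrite bin_small ?mul0r // /l; case: (e); lia.
have -> : alt_sum e N K (m + K) = alt_sum e K.+1 K (m + K) :> F.
  apply: (@sum_ord_widen F _ _
    (fun j => (-1) ^+ j * (K ^_ j * 'C(m + K, j))%:R / (odd_fact e j)%:R)) => // j Kj.
  by rewrite ffact_small ?mulr0 ?mul0r.
rewrite (reindex_inj rev_ord_inj) /alt_sum mulr_sumr /=; apply: eq_bigr => j _.
have jK : (j <= K)%N by rewrite -ltnS.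
rewrite subSS; set k := (K - j)%N.
have Ek : K = (k + j)%N by rewrite /k; lia.
have E1 : ('C(l, m + k.*2) * 'C(m + k.*2, k) * (k`! * (m + k)`! * (2 ^ j * j`! * odd_fact e j)) = l`!)%N.
  rewrite -fact_odd_fact -(@bin_fact l (m + k.*2)); last by rewrite /l; lia.
  rewrite -(@bin_fact (m + k.*2) k); last lia.
  have -> : (l - (m + k.*2) = j.*2 + e)%N by rewrite /l; lia.
  have -> : (m + k.*2 - k = m + k)%N by lia.
  by ring.
have E2 : (K ^_ j * k`! = K`!)%N by exact: ffact_fact.
have E3 : ('C(m + K, j) * j`! * (m + k)`! = (m + K)`!)%N.
  rewrite bin_ffact -(@ffact_fact (m + K) j); last lia.
  by have -> : (m + K - j = m + k)%N by lia.
have nz (n : nat) : (0 < n)%N -> n%:R != 0 :> F by rewrite pnatr_eq0 -lt0n.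
have h0 : (- 2^-1 : F) != 0 by rewrite oppr_eq0 invr_eq0 nz.
have E4 : (- 2^-1) ^+ K * 2 ^+ j * (-1) ^+ j = (- 2^-1) ^+ k :> F.
  rewrite {1}Ek exprD -!mulrA -!exprMn.
  have -> : - 2^-1 * (2 * -1) = 1 :> F by field.
  by rewrite expr1n mulr1.
rewrite -E1 -E2 -E3 -E4 !natrM natrX.
field.
by rewrite !nz ?fact_gt0 ?odd_fact_gt0 ?bin_gt0 ?ffact_gt0 //; lia.
Qed.

Lemma trinom_eq0 (F : numFieldType) (e : bool) (N K m : nat) : (K < N)%N ->
  trinom (m + K.*2 + e) m = 0 :> F -> alt_sum e N K (m + K) = 0 :> F.
Proof.
move=> KN; rewrite (@trinom_alt_sum F e N K m KN) => /eqP.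
rewrite mulf_eq0 => /orP[|/eqP //].
rewrite !mulf_eq0 invr_eq0 expf_eq0 oppr_eq0 invr_eq0 !pnatr_eq0 muln_eq0 andbF orbF.
by rewrite !eqn0Ngt !fact_gt0.
Qed.

(** * The sum modulo 2 *)

Lemma alternating_sum_even (F : numFieldType) (N : nat) (n : nat -> nat) :
  \sum_(j < N) (-1) ^+ j * (n j)%:R = 0 :> F -> ~~ odd (\sum_(j < N) n j).
Proof.
move=> s0; suff /eqP : (\sum_(j < N) n j)%:R = (\sum_(j < N) odd j * n j).*2%:R :> F.
  by rewrite eqr_nat => /eqP ->; rewrite odd_double.
rewrite -muln2 natrM -[LHS]subr0 -s0 !natr_sum -sumrB mulr_suml.
apply: eq_bigr => j _; rewrite -signr_odd.
by case: (odd j); rewrite /= ?expr1 ?expr0 ?mul1n ?mul0n; ring.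
Qed.

Lemma odd_odd_fact (e : bool) (j : nat) : odd (odd_fact e j).
Proof.
rewrite /odd_fact; elim: j => [|j IH]; first by rewrite big_ord0.
by rewrite big_ord_recr oddM IH /= oddD !odd_double.
Qed.

Lemma dvdn_odd_fact (e : bool) (i j : nat) : (i <= j)%N -> (odd_fact e i %| odd_fact e j)%N.
Proof.
move=> ij; rewrite /odd_fact -!(big_mkord xpredT (fun t => (t.*2 + e.*2).+1)).
by rewrite [in X in (_ %| X)%N](big_cat_nat (n := i)) //= dvdn_mulr.
Qed.

Lemma odd_divn (d n : nat) : (d %| n)%N -> odd n -> odd (n %/ d).
Proof.
move=> /dvdnP[q ->]; rewrite oddM => /andP[oq od].
by rewrite mulnK // odd_gt0.
Qed.

(** The odd cofactors [w j] clear the denominators. For j >= 2 the factor j! in K^_j makes the term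
    even, which leaves 1 + KM modulo 2. *)
Lemma alt_sum_odd (F : numFieldType) (e : bool) (N K M : nat) : (1 < N)%N ->
  alt_sum e N K M = 0 :> F -> odd K && odd M.
Proof.
move=> N1 s0; pose w j := (odd_fact e N %/ odd_fact e j)%N.
have wodd j : (j <= N)%N -> odd (w j).
  by move=> jN; apply: odd_divn; rewrite ?dvdn_odd_fact ?odd_odd_fact.
have : ~~ odd (\sum_(j < N) K ^_ j * 'C(M, j) * w j).
  apply: (@alternating_sum_even F N (fun j => K ^_ j * 'C(M, j) * w j)%N).
  transitivity ((odd_fact e N)%:R * alt_sum e N K M : F); last by rewrite s0 mulr0.
  rewrite /alt_sum mulr_sumr.
  apply: eq_bigr => j _.
  rewrite -(divnK (@dvdn_odd_fact e j N (ltnW (ltn_ord j)))) -/(w j) !natrM; field.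
  by rewrite pnatr_eq0 -lt0n odd_fact_gt0.
case: N N1 @w wodd {s0} => [|[|N]] // _ w wodd.
rewrite !big_ord_recl /= ffactn0 bin0 ffactn1 bin1 !oddD !oddM !wodd //= andbT.
suff -> : odd (\sum_(j < N) K ^_ (bump 0 (bump 0 j)) * 'C(M, bump 0 (bump 0 j))
    * w (bump 0 (bump 0 j))) = false.
  by case: (odd K); case: (odd M).
apply/negbTE; rewrite -dvdn2; apply: dvdn_sum => j _.
rewrite -mulnA; apply: dvdn_mulr; rewrite -[bump 0 (bump 0 j)]/(j.+2) -bin_ffact.
by rewrite dvdn_mull // !factS mulnA dvdn_mulr // dvdn2 oddM /= andNb.
Qed.

(** * Pairing consecutive terms; the sum modulo 4 *)

Lemma ffactzSr (n j : nat) : (n ^_ j.+1)%:Z = (n ^_ j)%:Z * (n%:Z - j%:Z).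
Proof.
rewrite ffactnSr PoszM; case: (leqP j n) => [jn|nj]; first by rewrite subzn.
by rewrite ffact_small // !mul0r.
Qed.

(** The odd factors of (2a+1)^_(2i), kept in [int] because they turn negative for t > a. *)
Definition odd_ffact (i a : nat) : int := \prod_(t < i) (2 * a%:Z + 1 - 2 * t%:Z).

Lemma ffact_double (i a : nat) :
  (a.*2.+1 ^_ i.*2)%:Z = 2 ^+ i * (a ^_ i)%:Z * odd_ffact i a.
Proof.
rewrite /odd_ffact; elim: i => [|i IH]; first by rewrite big_ord0.
rewrite doubleS !ffactzSr IH big_ord_recr exprS /=.
have -> : a.*2.+1%:Z = 2 * a%:Z + 1 by lia.
have -> : i.*2%:Z = 2 * i%:Z by lia.
have -> : i.*2.+1%:Z = 2 * i%:Z + 1 by lia.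
by ring.
Qed.

Lemma bin_double (i c : nat) :
  ('C(c.*2.+1, i.*2) * odd_fact false i)%:Z = 'C(c, i)%:Z * odd_ffact i c.
Proof.
have := ffact_double i c; rewrite -bin_ffact -(bin_ffact c).
have := fact_odd_fact false i; rewrite addn0 => -> E.
have nz : (2 ^ i * i`!)%:Z != 0 by rewrite eqz_nat -lt0n muln_gt0 expn_gt0 fact_gt0.
have E2 : (2 ^ i)%:Z = 2 ^+ i by rewrite -!natz natrX.
apply: (mulfI nz); move: E; rewrite !PoszM E2 => E.
transitivity ('C(c.*2.+1, i.*2)%:Z * (2 ^+ i * i`!%:Z * (odd_fact false i)%:Z)); first by ring.
by rewrite E; ring.
Qed.

(* Half of (2i+1)(4i+1+2e) - (2a+1-2i)(2c+1-2i), the numerator left by adding the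
   terms of index 2i and 2i+1. *)
Definition pair_factor (e : bool) (i a c : nat) : int :=
  4 * i%:Z ^+ 2 + 3 * i%:Z + e%:Z * (2 * i%:Z + 1)
    - 2 * (a%:Z - i%:Z) * (c%:Z - i%:Z) - (a%:Z + c%:Z - 2 * i%:Z).

(** X_i(a, c); the corresponding unit is 1 / [pair_den e i], whose denominator is odd. *)
Definition pair_term (e : bool) (i a c : nat) : int :=
  (a ^_ i)%:Z * 'C(c, i)%:Z * (odd_ffact i a * odd_ffact i c) * pair_factor e i a c.

Definition pair_den (e : bool) (i : nat) : nat :=
  odd_fact false i.+1 * odd_fact e i.*2.+1.

(** The term of index 2i+1 is the one of index 2i times - (2a+1-2i)(2c+1-2i) / ((2i+1)(4i+1+2e)).
    Numerator and denominator are odd, so their difference yields the extra factor 2. *)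
Lemma alt_sum_pairs (F : numFieldType) (e : bool) (I a c : nat) :
  alt_sum e I.*2 a.*2.+1 c.*2.+1 =
    \sum_(i < I) 2 ^+ i.+1 * (pair_term e i a c)%:~R / (pair_den e i)%:R :> F.
Proof.
rewrite /alt_sum; elim: I => [|I IH]; first by rewrite !big_ord0.
rewrite doubleS !big_ord_recr /= IH -addrA; congr (_ + _).
have nz e' j : (odd_fact e' j)%:R != 0 :> F by rewrite pnatr_eq0 -lt0n odd_fact_gt0.
have natM2 (n : nat) : n.*2%:R = 2 * n%:R :> F by rewrite -mul2n natrM.
have natD (n : nat) : n.*2.+1%:R = 2 * n%:R + 1 :> F by rewrite -[n.*2.+1]addn1 natrD natM2.
have E0 : (a.*2.+1 ^_ I.*2)%:R = 2 ^+ I * (a ^_ I)%:R * (odd_ffact I a)%:~R :> F.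
  by rewrite !pmulrn ffact_double !rmorphM rmorphXn.
have E1 : (a.*2.+1 ^_ I.*2.+1)%:R = (a.*2.+1 ^_ I.*2)%:R * (2 * a%:R + 1 - 2 * I%:R) :> F.
  by rewrite pmulrn ffactzSr rmorphM rmorphB /= -!pmulrn natD natM2.
have E2 : 'C(c.*2.+1, I.*2)%:R = 'C(c, I)%:R * (odd_ffact I c)%:~R / (odd_fact false I)%:R :> F.
  apply: (canRL (mulfK (nz _ _))).
  by rewrite -natrM pmulrn bin_double rmorphM /= -pmulrn.
have I1 : I.*2.+1%:R != 0 :> F by rewrite pnatr_eq0.
have E3 : 'C(c.*2.+1, I.*2.+1)%:R = 'C(c.*2.+1, I.*2)%:R * (2 * c%:R + 1 - 2 * I%:R) / I.*2.+1%:R :> F.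
  apply: (canRL (mulfK I1)); rewrite -[LHS]natrM (mulnC 'C(_, _)) mul_bin_left natrM mulrC.
  case: (leqP I.*2 c.*2.+1) => [Ic|cI]; last by rewrite bin_small // !mul0r.
  by rewrite natrB // natD natM2.
have E4 : (odd_fact e I.*2.+1)%:R = (odd_fact e I.*2)%:R * (4 * I%:R + 2 * e%:R + 1) :> F.
  rewrite /odd_fact big_ord_recr natrM; congr (_ * _).
  by rewrite -[(_ + _).+1]addn1 !natrD -!mul2n !natrM mulrA -natrM.
have E5 : (odd_fact false I.+1)%:R = (odd_fact false I)%:R * I.*2.+1%:R :> F.
  by rewrite /odd_fact big_ord_recr natrM addn0.
have I2 : 4 * I%:R + 2 * e%:R + 1 != 0 :> F.
  by move: (nz e I.*2.+1); rewrite E4 mulf_eq0 negb_or => /andP[].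
rewrite natD in I1 E3 E5.
have E6 : (pair_factor e I a c)%:~R = 4 * I%:R ^+ 2 + 3 * I%:R + e%:R * (2 * I%:R + 1)
    - 2 * (a%:R - I%:R) * (c%:R - I%:R) - (a%:R + c%:R - 2 * I%:R) :> F.
  by rewrite /pair_factor !(rmorphD, rmorphN, rmorphM, rmorphXn) /= -!pmulrn; ring.
rewrite /pair_term /pair_den (natrM _ (odd_fact _ _)).
rewrite !(natrM _ (_ ^_ _) 'C(_, _)) !rmorphM /= E6 -!pmulrn E1 E3 E4 E5 E2 E0.
rewrite !exprS -[(-1) ^+ I.*2]signr_odd odd_double expr0; field.
by rewrite I1 I2 !nz.
Qed.

Definition pair_weight (e : bool) (I i : nat) : nat := (pair_den e I %/ pair_den e i)%N.

Lemma dvdn_pair_den (e : bool) (i I : nat) : (i <= I)%N ->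
  (pair_den e i %| pair_den e I)%N.
Proof. by move=> iI; apply: dvdn_mul; apply: dvdn_odd_fact; lia. Qed.

Lemma odd_pair_weight (e : bool) (I i : nat) : (i <= I)%N -> odd (pair_weight e I i).
Proof.
by move=> iI; apply: odd_divn; rewrite ?dvdn_pair_den // oddM !odd_odd_fact.
Qed.

Lemma pair_sum_eq0 (F : numFieldType) (e : bool) (I a c : nat) :
  alt_sum e I.*2 a.*2.+1 c.*2.+1 = 0 :> F ->
  \sum_(i < I) (pair_weight e I i)%:Z * 2 ^+ i.+1 * pair_term e i a c = 0.
Proof.
rewrite alt_sum_pairs => s0; apply: (@intr_inj F); rewrite rmorph_sum /=.
transitivity ((pair_den e I)%:R * \sum_(i < I) 2 ^+ i.+1 * (pair_term e i a c)%:~R /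
  (pair_den e i)%:R : F); last by rewrite s0 mulr0.
rewrite mulr_sumr; apply: eq_bigr => i _.
rewrite -(divnK (@dvdn_pair_den e i I (ltnW (ltn_ord i)))) -/(pair_weight e I i).
rewrite natrM !rmorphM rmorphXn /= -!pmulrn; field.
by rewrite !pnatr_eq0 -!lt0n !odd_fact_gt0.
Qed.

(** All pairs with i >= 1 are divisible by 4, and the pair i = 0 is 2 (e - 2ac - (a+c)) times an odd
    weight. *)
Lemma alt_sum_parity (F : numFieldType) (e : bool) (I a c : nat) : (0 < I)%N ->
  alt_sum e I.*2 a.*2.+1 c.*2.+1 = 0 :> F -> odd (a + c) = e.
Proof.
case: I => // I _ /pair_sum_eq0; rewrite big_ord_recl /=.
have -> : \sum_(i < I) (pair_weight e I.+1 (bump 0 i))%:Z * 2 ^+ (bump 0 i).+1 *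
    pair_term e (bump 0 i) a c =
  4 * \sum_(i < I) (pair_weight e I.+1 i.+1)%:Z * 2 ^+ i * pair_term e i.+1 a c.
  rewrite mulr_sumr; apply: eq_bigr => i _; rewrite -[bump 0 i]/(i.+1) !exprS; ring.
rewrite /pair_term ffactn0 bin0 /odd_ffact !big_ord0 /pair_factor /=.
have := odd_pair_weight e I.+1 0 isT; move: (pair_weight _ _ _) => w ow.
move: (\sum_(i < I) _) => q E.
have {}E : w%:Z * (e%:Z - 2 * (a%:Z * c%:Z) - (a%:Z + c%:Z)) + 2 * q = 0.
  by apply: (@mulfI _ 2%:Z) => //; rewrite mulr0 -[RHS]E; ring.
have [u wu] : exists u, w = u.*2.+1 by exists w./2; rewrite -[LHS]odd_double_half ow.
rewrite wu in E; clear -E; case: e E => /= E; lia.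
Qed.

(** * Divisibility by a - b and uniqueness of the zero *)

Lemma dvdz_subM (d x x' y y' : int) :
  (d %| x - x')%Z -> (d %| y - y')%Z -> (d %| x * y - x' * y')%Z.
Proof.
move=> dx dy; have -> : x * y - x' * y' = (x - x') * y + x' * (y - y') by ring.
by apply: rpredD; [exact: dvdz_mulr | exact: dvdz_mull].
Qed.

Lemma dvdz_sub_ffact (i a b : nat) : (a%:Z - b%:Z %| (a ^_ i)%:Z - (b ^_ i)%:Z)%Z.
Proof.
elim: i => [|i IH]; first by rewrite !ffactn0 subrr dvdz0.
rewrite !ffactzSr; apply: dvdz_subM => //.
by have -> : a%:Z - i%:Z - (b%:Z - i%:Z) = a%:Z - b%:Z by ring.
Qed.

Lemma dvdz_sub_odd_ffact (i a b : nat) :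
  (a%:Z - b%:Z %| odd_ffact i a - odd_ffact i b)%Z.
Proof.
rewrite /odd_ffact; elim: i => [|i IH]; first by rewrite !big_ord0 subrr dvdz0.
rewrite !big_ord_recr; apply: dvdz_subM => //=.
by apply/dvdzP; exists 2; ring.
Qed.

(* The [i`!] of [a ^_ i = 'C(a, i) * i`!] can be moved onto ['C(c, i)], so it
   pays for the denominators in the difference of either factor. *)
Lemma dvdz_sub_pair_term (e : bool) (i a b n : nat) :
  (a%:Z - b%:Z %| pair_term e i a (a + n) - pair_term e i b (b + n))%Z.
Proof.
have dn : (a + n)%:Z - (b + n)%:Z = a%:Z - b%:Z by rewrite !PoszD; ring.
have dodd := dvdz_sub_odd_ffact i (a + n) (b + n); rewrite dn in dodd.
apply: dvdz_subM; last first.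
  by apply/dvdzP; exists (- 2 * (a%:Z - i%:Z + (b + n)%:Z - i%:Z) - 2);
    rewrite /pair_factor !PoszD; ring.
apply: dvdz_subM; last by apply: dvdz_subM => //; exact: dvdz_sub_odd_ffact.
have -> : (a ^_ i)%:Z * 'C(a + n, i)%:Z - (b ^_ i)%:Z * 'C(b + n, i)%:Z =
  ((a ^_ i)%:Z - (b ^_ i)%:Z) * 'C(a + n, i)%:Z
    + 'C(b, i)%:Z * (((a + n) ^_ i)%:Z - ((b + n) ^_ i)%:Z).
  by rewrite -!bin_ffact !PoszM; ring.
apply: rpredD; first exact/dvdz_mulr/dvdz_sub_ffact.
by rewrite -dn; exact/dvdz_mull/dvdz_sub_ffact.
Qed.

Lemma pair_term1_sub (e : bool) (a b n : nat) : odd n = e ->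
  exists y : int, pair_term e 1 a (a + n) - pair_term e 1 b (b + n) =
    (a%:Z - b%:Z) * (a%:Z + b%:Z + n%:Z + 2 * y).
Proof.
move=> on; pose p := n%:Z - (n./2)%:Z.
have np : n%:Z = 2 * p - e%:Z by rewrite /p -[n in n%:Z]odd_double_half on; lia.
(* (2x+1)(2(x+n)+1) = 1 + 2 s(x), and [pair_factor] at i = 1 equals 1 + 2 r(x) by n = 2p - e. *)
pose s (x : int) := x + (x + n%:Z) + 2 * x * (x + n%:Z).
pose r (x : int) := 4 + 2 * e%:Z - x - p - (x - 1) * (x + n%:Z - 1).
pose h (x : int) := x * (x + n%:Z) * (s x + r x + 2 * (s x * r x)).
have E x : pair_term e 1 x (x + n) = x%:Z * (x%:Z + n%:Z) + 2 * h x%:Z.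
  rewrite /pair_term /odd_ffact !big_ord1 /pair_factor ffactn1 bin1 !PoszD /h /s /r.
  by rewrite !np /=; ring.
have /dvdzP[y Hy] : (a%:Z - b%:Z %| h a%:Z - h b%:Z)%Z.
  have ds : (a%:Z - b%:Z %| s a - s b)%Z.
    by apply/dvdzP; exists (2 + 2 * (a%:Z + b%:Z + n%:Z)); rewrite /s; ring.
  have dr : (a%:Z - b%:Z %| r a - r b)%Z.
    by apply/dvdzP; exists (- 1 - (a%:Z + b%:Z + n%:Z - 2)); rewrite /r; ring.
  apply: dvdz_subM.
    by apply/dvdzP; exists (a%:Z + b%:Z + n%:Z); ring.
  have -> : s a + r a + 2 * (s a * r a) - (s b + r b + 2 * (s b * r b)) =
    (s a - s b) + (r a - r b) + 2 * (s a * r a - s b * r b) by ring.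
  apply: rpredD; first exact: rpredD.
  by apply: dvdz_mull; exact: dvdz_subM.
exists y; rewrite !E.
have -> : a%:Z * (a%:Z + n%:Z) + 2 * h a%:Z - (b%:Z * (b%:Z + n%:Z) + 2 * h b%:Z) =
  (a%:Z - b%:Z) * (a%:Z + b%:Z + n%:Z) + 2 * (h a - h b) by ring.
by rewrite Hy; ring.
Qed.

Lemma alt_sum_uniq (F : numFieldType) (e : bool) (I a b n : nat) : (1 < I)%N ->
  alt_sum e I.*2 a.*2.+1 (a + n).*2.+1 = 0 :> F ->
  alt_sum e I.*2 b.*2.+1 (b + n).*2.+1 = 0 :> F -> a = b.
Proof.
move=> I1 sa sb.
have on : odd n = e.
  by move: (@alt_sum_parity F e I a (a + n) (ltnW I1) sa); rewrite addnA addnn oddD odd_double.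
move: (@pair_sum_eq0 F e I a _ sa) (@pair_sum_eq0 F e I b _ sb); pose w := pair_weight e I.
have [w0 w1] : odd (w 0%N) /\ odd (w 1%N) by split; apply: odd_pair_weight; lia.
rewrite -/w; case: I I1 @w w0 w1 {sa sb} => [|[|I]] // _ w w0 w1.
rewrite !big_ord_recl /=; set ta := \sum_(i < I) _; set tb := \sum_(i < I) _ => Sa Sb.
(* The pairs with i >= 2 carry 2^(i+1), a multiple of 8. *)
have /dvdzP[q Hq] : (8 * (a%:Z - b%:Z) %| ta - tb)%Z.
  rewrite /ta /tb -sumrB; apply: rpred_sum => i _; rewrite -[bump 0 (bump 0 i)]/(i.+2).
  rewrite -mulrBr !exprS.
  have -> : (w i.+2)%:Z * (2 * (2 * (2 * 2 ^+ i))) = 8 * ((w i.+2)%:Z * 2 ^+ i) by ring.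
  by rewrite -mulrA dvdz_mul // dvdz_mull // dvdz_sub_pair_term.
have [y Hy] := @pair_term1_sub e a b n on.
have X0 x : pair_term e 0 x (x + n) = e%:Z - 2 * (x%:Z * (x%:Z + n%:Z)) - (x%:Z + (x%:Z + n%:Z)).
  by rewrite /pair_term ffactn0 bin0 /odd_ffact !big_ord0 /pair_factor PoszD; ring.
apply/eqP/negPn/negP => ab; have {}ab : 4 * (a%:Z - b%:Z) != 0 by lia.
have : 4 * (a%:Z - b%:Z) * ((w 1%N)%:Z * (a%:Z + b%:Z + n%:Z + 2 * y)
    - (w 0%N)%:Z * (a%:Z + b%:Z + n%:Z + 1) + 2 * q) = 0.
  rewrite -[0]subr0 -{1}Sa -{1}Sb !X0.
  transitivity ((w 0%N)%:Z * 2 ^+ 1 * (pair_term e 0 a (a + n) - pair_term e 0 b (b + n))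
     + (w 1%N)%:Z * 2 ^+ 2 * (pair_term e 1 a (a + n) - pair_term e 1 b (b + n)) + (ta - tb)).
    by rewrite Hy Hq !X0; ring.
  by rewrite !X0 -[bump 0 0]/1%N; ring.
move/eqP; rewrite mulf_eq0 (negPf ab) /= => /eqP.
(* With z = a + b + n the bracket is odd: both weights are odd and exactly one of z, z + 1 is
   odd. *)
rewrite -[w 0%N]odd_double_half -[w 1%N]odd_double_half w0 w1.
move: (w 0%N)./2 (w 1%N)./2 => u v; move: (a%:Z + b%:Z + n%:Z) => z; clear; lia.
Qed.

(** Here M = K + m with K and M odd, so m is even and c = a + m/2; the condition modulo 4 then fixes
    e. Only a remains free in l. *)
Lemma trinom_zero (F : numFieldType) (l m : nat) : (m <= l)%N -> trinom l m = 0 :> F ->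
  exists a : nat, let e := odd m./2 in
    [/\ ~~ odd m, l = (m + a.*2.+1.*2 + e)%N
      & forall I, (a < I)%N -> alt_sum e I.*2 a.*2.+1 (a + m./2).*2.+1 = 0 :> F].
Proof.
move=> ml; pose K := (l - m)./2; pose e := odd (l - m).
have lE : l = (m + K.*2 + e)%N.
  by rewrite -addnA [(K.*2 + e)%N]addnC odd_double_half subnKC.
rewrite lE => T0.
have S0 N : (K < N)%N -> alt_sum e N K (m + K) = 0 :> F.
  by move=> KN; exact: (@trinom_eq0 F e N K m KN T0).
have /andP[oK oM] := @alt_sum_odd F e K.+2 K (m + K) isT (S0 K.+2 (leqnSn _)).
have em : ~~ odd m by move: oM; rewrite oddD oK; case: (odd m).
pose a := K./2; have KE : K = a.*2.+1 by rewrite -[K]odd_double_half oK.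
have ME : (m + K = (a + m./2).*2.+1)%N.
  by rewrite KE -{1}[m]odd_double_half (negPf em); lia.
have Sa I : (a < I)%N -> alt_sum e I.*2 a.*2.+1 (a + m./2).*2.+1 = 0 :> F.
  by move=> aI; rewrite -KE -ME; apply: S0; rewrite KE; lia.
have eE : odd m./2 = e.
  have := @alt_sum_parity F e a.+1 a (a + m./2) isT (Sa a.+1 (ltnSn _)).
  by rewrite addnA addnn oddD odd_double.
by exists a; rewrite eE; split=> [||I /Sa] //; rewrite KE.
Qed.

Lemma trinom_zero_uniq (F : numFieldType) (l l' m : nat) : (m <= l)%N -> (m <= l')%N ->
  trinom l m = 0 :> F -> trinom l' m = 0 :> F -> l = l'.
Proof.
move=> ml ml' /(@trinom_zero F _ _ ml)[a [_ -> Sa]] /(@trinom_zero F _ _ ml')[b [_ -> Sb]].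
suff -> : a = b by [].
(* A common range exceeding a, b and 1. *)
pose I := (a + b).+2.
by apply: (@alt_sum_uniq F (odd m./2) I a b m./2); rewrite ?Sa ?Sb // /I; lia.
Qed.

(** * Divisibility by P_2 as vanishing of T(l, m) *)

Lemma assoc_legendre_polyE (l m : nat) :
  assoc_legendre_poly l m = legendre_factor l m *: legendre_int_poly l m.
Proof.
exact: is_legendre_poly_uniq (@assoc_legendre_polyP l m) (is_legendre_poly_int l m).
Qed.

Lemma legendre_factor_neq0 (l m : nat) : legendre_factor l m != 0.
Proof.
rewrite /legendre_factor RmultE RdivE RpowE !INRE mulf_neq0 //.
  by apply: expf_neq0; apply/eqP/not_0_IZR.
by rewrite mulf_neq0 ?invr_eq0 // pnatr_eq0 -lt0n fact_gt0.
Qed.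

Lemma exists_sqrt_third : exists x : R, 3 * x ^+ 2 = 1.
Proof.
exists (Num.sqrt 3^-1); rewrite sqr_sqrtr ?invr_ge0 ?ler0n // mulfV //.
by rewrite pnatr_eq0.
Qed.

Lemma legendre_poly2_factor (x : R) : 3 * x ^+ 2 = 1 ->
  legendre_poly 2 = (3 / 2) *: (('X - x%:P) * ('X - (- x)%:P)).
Proof.
move=> x3; rewrite legendre_poly2.
have -> : ('X - x%:P) * ('X - (- x)%:P) = 'X^2 - (x ^+ 2)%:P.
  by rewrite polyCN polyC_exp; ring.
rewrite [3 / 2]mulrC -scalerA; congr (_ *: _).
by rewrite scalerBr -[3 *: _%:P]mul_polyC -polyCM x3.
Qed.

(** P_2 has the two simple roots x and -x, both solving 3 y^2 = 1, and at each of them the integral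
    polynomial is a nonzero multiple of T(l, m). *)
Lemma legendre_poly2_dvd (l m : nat) :
  (legendre_poly 2 %| assoc_legendre_poly l m) <-> trinom l m = 0 :> R.
Proof.
have [x x3] := exists_sqrt_third.
have nx3 : 3 * (- x) ^+ 2 = 1 by rewrite sqrrN.
have x0 : x != 0.
  by apply/eqP => x0; move/eqP: x3; rewrite x0 expr0n mulr0 eq_sym oner_eq0.
have rootE (y : R) : 3 * y ^+ 2 = 1 -> y != 0 ->
    root (legendre_int_poly l m) y = (trinom l m == 0 :> R).
  move=> y3 y0; have := @horner_legendre_int_poly y l m y3.
  rewrite rootE -(mulrI_eq0 _ (mulfI (expf_neq0 (odd m) y0))) => ->.
  by rewrite mulrI_eq0 //; apply/mulfI/mulf_neq0; rewrite ?expf_neq0 ?parity_scale_neq0.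
rewrite (@legendre_poly2_factor x x3) assoc_legendre_polyE.
rewrite dvdpZr ?legendre_factor_neq0 // dvdpZl ?mulf_neq0 ?invr_eq0 ?pnatr_eq0 //.
split=> [dv|T0].
  apply/eqP; rewrite -(rootE x) // -dvdp_XsubCl; apply: dvdp_trans dv.
  exact: dvdp_mulr.
have := @uniq_roots_dvdp _ (legendre_int_poly l m) [:: x; - x].
rewrite !big_cons big_nil mulr1; apply.
  by rewrite /= !rootE ?oppr_eq0 // T0 eqxx.
by rewrite uniq_rootsE /= inE andbT -addr_eq0 -mulr2n mulrn_eq0.
Qed.

Theorem theorem2 :
  [/\ forall l : nat, legendre_poly 2 %| legendre_poly l <-> l = 2%N,
      forall l : nat, (2 <= l)%N ->
        (legendre_poly 2 %| assoc_legendre_poly l 2 <-> l = 5%N),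
      forall m : nat, ~~ odd m ->
        forall l l' : nat, (m <= l)%N -> (m <= l')%N ->
          legendre_poly 2 %| assoc_legendre_poly l m ->
          legendre_poly 2 %| assoc_legendre_poly l' m -> l = l'
    & forall m : nat, (1 <= m)%N -> odd m ->
        forall l : nat, (m <= l)%N ->
          ~~ (legendre_poly 2 %| assoc_legendre_poly l m)].
Proof.
have uniq_l m l l' : (m <= l)%N -> (m <= l')%N ->
    legendre_poly 2 %| assoc_legendre_poly l m ->
    legendre_poly 2 %| assoc_legendre_poly l' m -> l = l'.
  by move=> ml ml' /legendre_poly2_dvd T /legendre_poly2_dvd; exact: trinom_zero_uniq T.
have dvd5 : legendre_poly 2 %| assoc_legendre_poly 5 2.
  apply/legendre_poly2_dvd; rewrite /trinom 2!big_ord_recl big1 => [|k _]; last first.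
    by rewrite bin_small ?mul0r //= /bump /=; lia.
  (* T(5, 2) = 'C(5, 2) - 'C(5, 4) 'C(4, 1) / 2 = 10 - 10. *)
  by transitivity (10 * 1 + (20 * (- 2^-1) + 0) : GRing.Field.sort R); last field.
split=> [l|l l2|m _|m _ om l ml].
(* P_2 divides itself, so the only zero for m = 0 is l = 2. *)
- by split=> [dv|->]; [apply: uniq_l dv (dvdpp _) | exact: dvdpp].
- by split=> [dv|->]; first exact: uniq_l dv dvd5.
- exact: uniq_l.
- apply/negP => /legendre_poly2_dvd /(@trinom_zero _ _ _ ml)[a []].
  by rewrite om.
Qed.
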